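(* Let $K$ be a field and $K\langle X\rangle=K\langle X_1,\ldots,X_n\rangle$ the free $K$-algebra on $X=\{X_1,\ldots,X_n\}$, equipped with a fixed weight $\mathbb{N}$-gradation, and let $\prec_{gr}$ be an $\mathbb{N}$-graded lexicographic ordering on the set $\mathcal{B}$ of all monomials (words) of $K\langle X\rangle$ with respect to this gradation. Let $\mathcal{G}=\{g_1,\ldots,g_s\}$ be a finite (but not necessarily homogeneous) Gröbner basis, with respect to $\prec_{gr}$, for the proper ideal $I=\langle\mathcal{G}\rangle$ of $K\langle X\rangle$, such that $\mathbf{LM}(\mathcal{G})\cap X=\emptyset$ and $\mathbf{LM}(\mathcal{G})$ is reduced. Put $A=K\langle X\rangle/I$, with the $\mathbb{N}$-filtration $FA$ induced by the $\mathbb{N}$-grading filtration of $K\langle X\rangle$, and let $\widetilde{A}$ be the Rees algebra of $A$ determined by $FA$. If the monomial algebra $\overline{A}=K\langle X\rangle/\langle\mathbf{LM}(\mathcal{G})\rangle$ is semi-prime, then $\widetilde{A}$ is semiprimitive.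
   Context: $\mathbb{N}$ is the set of nonnegative integers. Algebras are associative $K$-algebras with identity $1$, ideals are two-sided, and $\langle U\rangle$ denotes the two-sided ideal generated by a subset $U$. $\mathcal{B}$ denotes the standard $K$-basis of $K\langle X\rangle$ consisting of all monomials (words) in the $X_i$, including $1$. Weight $\mathbb{N}$-gradation: each $X_i$ is assigned a positive integer degree $m_i$, the degree $d(w)$ of a word $w$ is the sum of the degrees of its letters, and $K\langle X\rangle=\bigoplus_{p\in\mathbb{N}}K\langle X\rangle_p$, where $K\langle X\rangle_p$ is the $K$-span of all words of degree $p$. $\mathbb{N}$-graded lexicographic ordering: fix a total order on the letters $X_1,\ldots,X_n$; then $u\prec_{gr}v$ if and only if $d(u)<d(v)$, or $d(u)=d(v)$ and $u$ is smaller than $v$ in the (left-to-right) lexicographic order on words determined by the order on the letters. This is a monomial ordering, i.e. a well-ordering on $\mathcal{B}$ such that, for all $w,u,v,s\in\mathcal{B}$, $u\prec_{gr}v$ implies $wus\prec_{gr}wvs$, and $v=wus$ with $w\neq 1$ or $s\neq 1$ implies $u\prec_{gr}v$. Leading monomials: for nonzero $f=\sum_{i=1}^s\lambda_iw_i$ with $\lambda_i\in K\setminus\{0\}$ and $w_1\prec_{gr}\cdots\prec_{gr}w_s$ in $\mathcal{B}$, $\mathbf{LM}(f)=w_s$. For $S\subseteq K\langle X\rangle$, $\mathbf{LM}(S)$ is the set of leading monomials of the nonzero elements of $S$. Gröbner basis: a subset $\mathcal{G}\subseteq I\setminus\{0\}$ is a Gröbner basis of the ideal $I$ if $\langle\mathbf{LM}(I)\rangle=\langle\mathbf{LM}(\mathcal{G})\rangle$.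 Reduced: for $u,v\in\mathcal{B}$, $v$ divides $u$ if $u=wvs$ for some $w,s\in\mathcal{B}$. A subset $\Omega\subseteq\mathcal{B}$ is reduced if for all $u,v\in\Omega$ with $u\neq v$, $v$ does not divide $u$. Filtration and Rees algebra: the $\mathbb{N}$-grading filtration of $K\langle X\rangle$ is $F_pK\langle X\rangle=\bigoplus_{q\le p}K\langle X\rangle_q$, $p\in\mathbb{N}$. For $A=K\langle X\rangle/I$, the induced filtration $FA=\{F_pA\}_{p\in\mathbb{N}}$ is $F_pA=(F_pK\langle X\rangle+I)/I$. The Rees algebra of $A$ determined by $FA$ is the $\mathbb{N}$-graded algebra $\widetilde{A}=\bigoplus_{p\in\mathbb{N}}F_pA$ with the multiplication induced by $F_pA\,F_qA\subseteq F_{p+q}A$ for all $p,q\in\mathbb{N}$. An algebra $R$ is semi-prime if $a\in R$ and $aRa=\{0\}$ imply $a=0$. It is semiprimitive if its Jacobson radical is $J(R)=\{0\}$. *)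

(* Defs.v *)
From HB Require Import structures.
From mathcomp Require Import all_boot all_order all_algebra.
From mathcomp Require Import finmap.
From mathcomp Require Import boolp classical_sets.
From mathcomp.multinomials Require Import monalg.

Set Implicit Arguments.
Unset Strict Implicit.
Unset Printing Implicit Defensive.

Import GRing.Theory.
Import Quotient.

Local Open Scope ring_scope.
Local Open Scope classical_set_scope.
Local Open Scope quotient_scope.

(* Two-sided ideals and quotient rings. MathComp only equips quotients of      *)
(* commutative rings with a multiplication; its [quot] is reused here as a     *)
(* Z-module. Ideals may be improper, so a quotient is a pzRingType, and a      *)
(* nzRingType when the ideal is proper.                                        *)

HB.mixin Record isTwoSided (R : nzRingType) (S : R -> bool) := {
  two_sidedMl : forall a u, u \in S -> a * u \in S;
  two_sidedMr : forall a u, u \in S -> u * a \in S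
}.

#[short(type="twoSidedIdeal")]
HB.structure Definition TwoSidedIdeal (R : nzRingType) :=
  {S of GRing.ZmodClosed R S & isTwoSided R S}.

#[short(type="properTwoSidedIdeal")]
HB.structure Definition ProperTwoSidedIdeal (R : nzRingType) :=
  {S of TwoSidedIdeal R S & isProperIdeal R S}.

Section GeneratedIdeal.
Variables (R : nzRingType) (U : set R).

Definition ideal_gen : R -> bool := fun x =>
  `[< forall J : twoSidedIdeal R, (forall u, U u -> u \in J) -> x \in J >].

Lemma ideal_genP x :
  reflect (forall J : twoSidedIdeal R, (forall u, U u -> u \in J) -> x \in J)
          (x \in ideal_gen).
Proof. exact: asboolP. Qed.

Fact ideal_gen_zmod : zmod_closed ideal_gen.
Proof.
split=> [|x y /ideal_genP Ux /ideal_genP Uy]; apply/ideal_genP=> J UJ.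
  exact: rpred0.
by rewrite rpredB ?Ux ?Uy.
Qed.

HB.instance Definition _ := GRing.isZmodClosed.Build R ideal_gen ideal_gen_zmod.

Fact ideal_genMl a u : u \in ideal_gen -> a * u \in ideal_gen.
Proof.
move=> /ideal_genP Uu; apply/ideal_genP=> J UJ.
by apply: two_sidedMl; apply: Uu.
Qed.

Fact ideal_genMr a u : u \in ideal_gen -> u * a \in ideal_gen.
Proof.
move=> /ideal_genP Uu; apply/ideal_genP=> J UJ.
by apply: two_sidedMr; apply: Uu.
Qed.

HB.instance Definition _ :=
  isTwoSided.Build R ideal_gen ideal_genMl ideal_genMr.

End GeneratedIdeal.

Definition quot_ring (R : nzRingType) (I : twoSidedIdeal R) := {quot I}.

Section QuotientRing.
Variables (R : nzRingType) (I : twoSidedIdeal R).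

HB.instance Definition _ := GRing.Zmodule.on (quot_ring I).

Definition quot_pi (x : R) : quot_ring I := \pi_(quot I) x.
Definition quot_repr (a : quot_ring I) : R := repr (a : quot I).

Lemma quot_reprK : cancel quot_repr quot_pi.
Proof. exact: reprK. Qed.

Lemma quot_piP x y : quot_pi x = quot_pi y <-> x - y \in I.
Proof. by rewrite (idealrBE I); split=> [/eqP|/eqP]. Qed.

Lemma quot_ringW (P : quot_ring I -> Prop) :
  (forall x, P (quot_pi x)) -> forall a, P a.
Proof. by move=> Ppi a; rewrite -[a]quot_reprK. Qed.

Fact quot_pi_zmod : zmod_morphism quot_pi.
Proof. exact: pi_is_zmod_morphism. Qed.

HB.instance Definition _ :=
  GRing.isZmodMorphism.Build R (quot_ring I) quot_pi quot_pi_zmod.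

Definition quot_one : quot_ring I := quot_pi 1.
Definition quot_mul (a b : quot_ring I) : quot_ring I :=
  quot_pi (quot_repr a * quot_repr b).

Lemma quot_piM x y : quot_mul (quot_pi x) (quot_pi y) = quot_pi (x * y).
Proof.
apply/quot_piP; set x' := quot_repr _; set y' := quot_repr _.
have hx : x' - x \in I by apply/quot_piP; rewrite quot_reprK.
have hy : y' - y \in I by apply/quot_piP; rewrite quot_reprK.
rewrite -[_ - _](subrKA (x' * y)) -mulrBr -mulrBl.
by apply: rpredD; [exact: two_sidedMl | exact: two_sidedMr].
Qed.

Fact quot_mulA : associative quot_mul.
Proof.
by elim/quot_ringW=> x; elim/quot_ringW=> y; elim/quot_ringW=> z;
  rewrite !quot_piM mulrA.
Qed.

Fact quot_mul1l : left_id quot_one quot_mul.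
Proof. by elim/quot_ringW=> x; rewrite quot_piM mul1r. Qed.

Fact quot_mul1r : right_id quot_one quot_mul.
Proof. by elim/quot_ringW=> x; rewrite quot_piM mulr1. Qed.

Fact quot_mulDl : left_distributive quot_mul +%R.
Proof.
elim/quot_ringW=> x; elim/quot_ringW=> y; elim/quot_ringW=> z.
by rewrite -raddfD !quot_piM mulrDl raddfD.
Qed.

Fact quot_mulDr : right_distributive quot_mul +%R.
Proof.
elim/quot_ringW=> x; elim/quot_ringW=> y; elim/quot_ringW=> z.
by rewrite -raddfD !quot_piM mulrDr raddfD.
Qed.

HB.instance Definition _ := GRing.Zmodule_isPzRing.Build (quot_ring I)
  quot_mulA quot_mul1l quot_mul1r quot_mulDl quot_mulDr.

Fact quot_pi_monoid : monoid_morphism quot_pi.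
Proof. by split=> // x y; rewrite -quot_piM. Qed.

HB.instance Definition _ :=
  GRing.isMonoidMorphism.Build R (quot_ring I) quot_pi quot_pi_monoid.

Lemma quot_pi_eq0 x : (quot_pi x == 0) = (x \in I).
Proof.
rewrite -(raddf0 quot_pi) -{2}[x]subr0.
by apply/eqP/idP => [/quot_piP|?]; last exact/quot_piP.
Qed.

End QuotientRing.

Section ProperQuotientRing.
Variables (R : nzRingType) (I : properTwoSidedIdeal R).

Fact quot_ring_nonzero : (1 : quot_ring I) != 0.
Proof.
rewrite -(rmorph1 (@quot_pi R I)) quot_pi_eq0.
by have [] := @proper_ideal_subproof R I.
Qed.

HB.instance Definition _ :=
  GRing.PzSemiRing_isNonZero.Build (quot_ring I) quot_ring_nonzero.

End ProperQuotientRing.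

Definition semiprime (R : pzRingType) :=
  forall a : R, (forall r, a * r * a = 0) -> a = 0.

Definition left_ideal (R : pzRingType) (L : set R) :=
  [/\ L 0, forall x y, L x -> L y -> L (x + y) & forall a x, L x -> L (a * x)].

Definition maximal_left_ideal (R : pzRingType) (L : set R) :=
  [/\ left_ideal L, L <> setT
    & forall L' : set R, left_ideal L' -> L `<=` L' -> L' <> setT -> L' = L].

Definition jacobson_radical (R : pzRingType) : set R :=
  \bigcap_(L in @maximal_left_ideal R) L.

Arguments jacobson_radical : clear implicits.

Definition semiprimitive (R : pzRingType) := jacobson_radical R = [set 0].

Record filtration (R : nzRingType) := Filtration {
  fil :> nat -> set R;
  fil0 : forall p, fil p 0;
  filB : forall p x y, fil p x -> fil p y -> fil p (x - y);
  fil1 : fil 0%N 1;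
  filM : forall p q x y, fil p x -> fil q y -> fil (p + q)%N (x * y);
  filS : forall p, fil p `<=` fil p.+1;
  fil_exhaustive : forall x, exists p, fil p x
}.

Section QuotientFiltration.
Variables (R : nzRingType) (F : filtration R) (I : properTwoSidedIdeal R).

Definition quot_fil p : set (quot_ring I) := @quot_pi R I @` F p.

Fact quot_fil0 p : quot_fil p 0.
Proof. by exists 0; [exact: fil0 | rewrite rmorph0]. Qed.

Fact quot_filB p a b : quot_fil p a -> quot_fil p b -> quot_fil p (a - b).
Proof.
by move=> [x Fx <-] [y Fy <-]; exists (x - y); [exact: filB | rewrite rmorphB].
Qed.

Fact quot_fil1 : quot_fil 0%N 1.
Proof. by exists 1; [exact: fil1 | rewrite rmorph1]. Qed.

Fact quot_filM p q a b :
  quot_fil p a -> quot_fil q b -> quot_fil (p + q)%N (a * b).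
Proof.
by move=> [x Fx <-] [y Fy <-]; exists (x * y); [exact: filM | rewrite rmorphM].
Qed.

Fact quot_filS p : quot_fil p `<=` quot_fil p.+1.
Proof. by move=> _ [x Fx <-]; exists x => //; exact: filS. Qed.

Fact quot_fil_exhaustive a : exists p, quot_fil p a.
Proof.
have [p Fx] := fil_exhaustive F (quot_repr a).
by exists p, (quot_repr a); rewrite ?quot_reprK.
Qed.

Definition quot_filtration : filtration (quot_ring I) :=
  Filtration quot_fil0 quot_filB quot_fil1 quot_filM quot_filS
    quot_fil_exhaustive.

End QuotientFiltration.

(* The direct sum of the F p, p in nat: a finitely supported family (a_p)_p    *)
(* with a_p in F p is the polynomial with coefficients a_p, and the product of *)
(* families is the convolution product of {poly A}.                            *)

Section ReesAlgebra.
Variables (A : nzRingType) (F : filtration A).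

Definition rees_pred : {pred {poly A}} := fun f => `[< forall p, F p f`_p >].

Record rees := Rees { rees_val :> {poly A}; _ : rees_val \in rees_pred }.

HB.instance Definition _ := [isSub for rees_val].
HB.instance Definition _ := [Choice of rees by <:].

Lemma filD p x y : F p x -> F p y -> F p (x + y).
Proof.
move=> Fx Fy; rewrite -[y]opprK -[- y]add0r; apply: filB => //.
by apply: filB => //; exact: fil0.
Qed.

Fact rees_subring : subring_closed rees_pred.
Proof.
split=> [|f g /asboolP Ff /asboolP Fg|f g /asboolP Ff /asboolP Fg];
  apply/asboolP=> p.
- by rewrite coef1; case: p => [|p]; [exact: fil1 | exact: fil0].
- by rewrite coefB; exact: filB.
- rewrite coefM; elim/big_ind: _ => [|x y|i _]; [exact: fil0 | exact: filD |].
by have := filM (Ff i) (Fg (p - i)%N); rewrite subnKC ?leq_ord.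
Qed.

HB.instance Definition _ :=
  GRing.SubChoice_isSubNzRing.Build {poly A} rees_pred rees rees_subring.

End ReesAlgebra.

(* The free algebra K<X_0, ..., X_(n-1)>, as the algebra of the free monoid on *)
(* 'I_n; the letter X_i is [fmu i], and the word w, seen in the algebra, is    *)
(* [<< w >>].                                                                  *)

Notation word n := {fmonom 'I_n}.
Notation free_algebra K n := {malg K[word n]}.

Definition letters n : set (word n) := range (@fmu 'I_n).
Arguments letters : clear implicits.

Definition word_divides n (v u : word n) :=
  exists w s : word n, u = mmul (mmul w v) s.

Definition reduced n (Omega : set (word n)) :=
  forall u v, Omega u -> Omega v -> u <> v -> ~ word_divides v u.

Definition wdeg n (m : 'I_n -> nat) (w : word n) : nat :=
  (\sum_(i <- (w : seq 'I_n)) m i)%N.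

Fixpoint lex_lt (T : eqType) (le : rel T) (s t : seq T) : bool :=
  match s, t with
  | _, [::] => false
  | [::], _ :: _ => true
  | x :: s', y :: t' => if x == y then lex_lt le s' t' else le x y
  end.

Definition grlex_lt n (m : 'I_n -> nat) (le : rel 'I_n) : rel (word n) :=
  fun u v => (wdeg m u < wdeg m v)%N || (wdeg m u == wdeg m v) && lex_lt le u v.

Definition is_LM (K : fieldType) n (lt : rel (word n)) (f : free_algebra K n)
    (w : word n) :=
  w \in msupp f /\ forall v, v \in msupp f -> v <> w -> lt v w.

Definition LM (K : fieldType) n (lt : rel (word n))
    (S : set (free_algebra K n)) : set (word n) :=
  [set w | exists f, [/\ S f, f <> 0 & is_LM lt f w]].

Definition monomial_ideal (K : fieldType) n (Omega : set (word n)) :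
    twoSidedIdeal (free_algebra K n) :=
  TwoSidedIdeal.clone (free_algebra K n)
    (ideal_gen [set (<< w >> : free_algebra K n) | w in Omega]) _.

Definition groebner_basis (K : fieldType) n (lt : rel (word n))
    (G : set (free_algebra K n)) (I : {pred free_algebra K n}) :=
  (forall g, G g -> g \in I /\ g <> 0) /\
  monomial_ideal K (LM lt [set` I]) =i monomial_ideal K (LM lt G).

Section WeightFiltration.
Variables (K : fieldType) (n : nat) (m : 'I_n -> nat).
Implicit Types f g : free_algebra K n.

Definition graded_part (p : nat) : set (free_algebra K n) :=
  [set f | forall w, w \in msupp f -> wdeg m w = p].

Definition weight_fil (p : nat) : set (free_algebra K n) :=
  [set f | exists2 h : 'I_p.+1 -> free_algebra K n,
     forall q : 'I_p.+1, graded_part q (h q) & f = \sum_q h q].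

Lemma weight_filP p f :
  weight_fil p f <-> forall w, w \in msupp f -> (wdeg m w <= p)%N.
Proof.
split=> [[h hh ->] w|df].
  apply: contraLR; rewrite -ltnNge -mcoeff_eq0 => pw.
  rewrite raddf_sum big1 //= => q _; apply/eqP; rewrite mcoeff_eq0.
  by apply: contraTN pw => /hh ->; rewrite -ltnNge.
pose h (q : 'I_p.+1) : free_algebra K n :=
  \sum_(w <- msupp f | wdeg m w == q) << f@_w *g w >>.
exists h => [q w|].
  rewrite -mcoeff_neq0 raddf_sum /=; apply: contra_neq_eq => dw.
  rewrite big1 // => v /eqP dv; rewrite mcoeffU.
  by case: eqP => // vw; rewrite -vw dv eqxx in dw.
rewrite {1}[f]monalgE (exchange_big_dep xpredT) //= [LHS]big_seq [RHS]big_seq.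
apply: eq_bigr => w wf; have dw : (wdeg m w < p.+1)%N by rewrite ltnS df.
by rewrite (big_pred1 (Ordinal dw)) // => q; rewrite -val_eqE /= eq_sym.
Qed.

Lemma wdeg1 : wdeg m (mone : word n) = 0%N.
Proof. by rewrite /wdeg fm1 big_nil. Qed.

Lemma wdegM (u v : word n) : wdeg m (mmul u v) = (wdeg m u + wdeg m v)%N.
Proof. by rewrite /wdeg fmM big_cat. Qed.

Fact weight_fil0 p : weight_fil p 0.
Proof. by apply/weight_filP => w; rewrite msupp0 inE. Qed.

Fact weight_filB p f g :
  weight_fil p f -> weight_fil p g -> weight_fil p (f - g).
Proof.
move=> /weight_filP df /weight_filP dg; apply/weight_filP => w.
by move/(fsubsetP (msuppB_le f g)); rewrite in_fsetU => /orP[/df|/dg].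
Qed.

Fact weight_fil1 : weight_fil 0%N 1.
Proof.
by apply/weight_filP => w; rewrite msuppU1 inE => /eqP ->; rewrite wdeg1.
Qed.

Fact weight_filM p q f g :
  weight_fil p f -> weight_fil q g -> weight_fil (p + q)%N (f * g).
Proof.
move=> /weight_filP df /weight_filP dg; apply/weight_filP => w.
move=> /msuppM_le [u [v [/df du /dg dv ->]]].
by rewrite wdegM leq_add.
Qed.

Fact weight_filS p : weight_fil p `<=` weight_fil p.+1.
Proof.
by move=> f /weight_filP df; apply/weight_filP => w /df /leqW.
Qed.

Fact weight_fil_exhaustive f : exists p, weight_fil p f.
Proof.
exists (\max_(w <- msupp f) wdeg m w)%N; apply/weight_filP => w wf.
exact: (@leq_bigmax_seq _ _ _ (wdeg m) w).
Qed.

Definition weight_filtration : filtration (free_algebra K n) :=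
  Filtration weight_fil0 weight_filB weight_fil1 weight_filM weight_filS
    weight_fil_exhaustive.

End WeightFiltration.

(* Main.v *)
Require Import Defs.
From HB Require Import structures.
From mathcomp Require Import all_boot all_order all_algebra.
From mathcomp Require Import finmap.
From mathcomp Require Import boolp classical_sets.
From mathcomp Require Import zify.
From mathcomp.multinomials Require Import monalg.

(** Call a word normal when no leading monomial of G divides it, and let t be
    the variable of the polynomial ring A[t], which contains the Rees algebra R
    as the subring of the sums of a_p t^p with a_p in F_p A.

    The proof separates two questions. The first one is purely ring-theoretic:
    R is semiprimitive as soon as every nonzero a in A has a right multiple
    a u that is not nilpotent ([rees_semiprimitive]). Let f be an element of
    J(R) of smallest width (degree minus order in t) among the nonzero ones, and
    let a be its leading coefficient, in degree P. For u in F_d A the element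
    (a t^P) (u t^d) f - f (u t^d) (a t^P) lies in J(R), and its width is
    smaller because its two terms of top degree cancel; so it is 0, that is,
    a u f_q = f_q u a for all q. Choose u with a u not nilpotent, and put
    g = f u t^(d+1). By the above the leading coefficient a u of g commutes with
    every coefficient of g, the constant coefficient of g is 0, and 1 - g has a
    left inverse because g is in J(R). As over a commutative ring, where the
    nonconstant coefficients of an invertible polynomial are nilpotent, this
    forces a u to be nilpotent ([lead_coef_nilpotent_of_inverse]), which is
    absurd.

    The second one is combinatorial: the condition on A holds. Division by the
    Groebner basis represents a nonzero a in A by some y whose leading monomial
    w is normal ([normal_LM_repr]), and an element with a normal leading
    monomial is not in I ([normal_LM_notin]). Leading monomials are
    multiplicative in the free algebra, so (a u)^k is nonzero for all k when u
    is a word such that all the powers of w u are normal. Semi-primeness of the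
    monomial algebra says that every normal w has a normal extension w v w
    ([semiprime_sandwich]). Iterating this makes w at least as long as every
    leading monomial of G, which is where the finiteness of G enters; after that
    every factor of a power of w v that could be a forbidden word is short
    enough to lie inside w v w, so w v w being normal is enough for all the
    powers of w v to be normal ([normal_power]). *)

Set Implicit Arguments.
Unset Strict Implicit.
Unset Printing Implicit Defensive.

Import GRing.Theory.

Local Open Scope ring_scope.
Local Open Scope classical_set_scope.

(** * The Jacobson radical *)

Section JacobsonRadical.
Variable R : pzRingType.
Implicit Types (x y r s : R) (L : set R).

(** Zorn's lemma is applied to the sets X for which X together with L0 is a
    proper left ideal, rather than to the proper left ideals containing L0, so
    that the union of the empty chain also qualifies. *)
Lemma proper_left_ideal_in_maximal L0 :
  left_ideal L0 -> ~ L0 1 -> exists2 L, maximal_left_ideal L & L0 `<=` L.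
Proof.
move=> idL0 L0'1.
pose P (X : set R) := left_ideal (X `|` L0) /\ ~ (X `|` L0) 1.
have [|L [[idL L'1] maxL]] := @Zorn_bigcup R P.
  move=> F FP totF; split; last first.
    move=> [[X FX X1]|//]; have [_] := FP _ FX; apply; by left.
  have mem X x : F X -> (X `|` L0) x -> (\bigcup_(Y in F) Y `|` L0) x.
    by move=> FX [Xx|L0x]; [left; exists X | right].
  split=> [|x y|a x].
  - by right; have [] := idL0.
  - move=> [[X FX Xx]|L0x] [[Y FY Yy]|L0y].
    + have [XY|YX] := totF _ _ FX FY.
        apply: (mem Y) => //; have [[_ addY _] _] := FP _ FY.
        by apply: addY; left=> //; exact: XY.
      apply: (mem X) => //; have [[_ addX _] _] := FP _ FX.
      by apply: addX; left=> //; exact: YX.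
    + apply: (mem X) => //; have [[_ addX _] _] := FP _ FX.
      by apply: addX; [left | right].
    + apply: (mem Y) => //; have [[_ addY _] _] := FP _ FY.
      by apply: addY; [right | left].
    + by right; have [_ addL0 _] := idL0; exact: addL0.
  - move=> [[X FX Xx]|L0x]; last first.
      by right; have [_ _ mulL0] := idL0; exact: mulL0.
    by apply: (mem X) => //; have [[_ _ mulX] _] := FP _ FX; apply: mulX; left.
exists (L `|` L0); last by move=> x; right.
split=> // [LT|L' idL' LL' L'T]; first by apply: L'1; rewrite LT.
have L'U : L' `|` L0 = L'.
  by apply/seteqP; split=> x; [case=> // L0x; apply: LL'; right | left].
apply/seteqP; split=> // x L'x; left; apply: contrapT => nLx.
apply: (maxL L'); last first.
  rewrite /P L'U; split=> // L'1'; apply: L'T; apply/seteqP; split=> // a _.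
  by have [_ _ mulL'] := idL'; rewrite -[a]mulr1; exact: mulL'.
split=> [y Ly|L'L]; first by apply: LL'; left.
exact/nLx/L'L.
Qed.

Lemma jacobson_radicalP x :
  jacobson_radical R x <-> forall r, exists c, c * (1 - r * x) = 1.
Proof.
split=> [Jx r|linv L maxL].
  apply: contrapT => noinv.
  pose L0 : set R := [set y | exists c, y = c * (1 - r * x)].
  have idL0 : left_ideal L0.
    split=> [|_ _ [c ->] [d ->]|a _ [c ->]].
    - by exists 0; rewrite mul0r.
    - by exists (c + d); rewrite mulrDl.
    - by exists (a * c); rewrite mulrA.
  have [|L maxL L0L] := proper_left_ideal_in_maximal idL0.
    by case=> c c1; apply: noinv; exists c.
  have [[_ addL mulL] LT _] := maxL.
  apply: LT; apply/seteqP; split=> // a _; rewrite -[a]mulr1; apply: (mulL).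
  rewrite -[1](subrK (r * x)); apply: addL.
    by apply: L0L; exists 1; rewrite mul1r.
  by apply: mulL; exact: Jx.
have [[L0 addL mulL] LT maxL'] := maxL; apply: contrapT => nLx.
pose L' : set R := [set y | exists2 z, L z & exists r, y = z + r * x].
have LL' : L `<=` L'.
  by move=> y Ly; exists y => //; exists 0; rewrite mul0r addr0.
have idL' : left_ideal L'.
  split=> [|_ _ [y Ly [r ->]] [z Lz [s ->]]|a _ [y Ly [r ->]]].
  - exact: LL'.
  - by exists (y + z); [exact: addL | exists (r + s); rewrite mulrDl addrACA].
  - by exists (a * y); [exact: mulL | exists (a * r); rewrite mulrDr mulrA].
have L'T : L' = setT.
  apply: contrapT => L'T; apply: nLx; rewrite -(maxL' _ idL' LL' L'T).
  by exists 0 => //; exists 1; rewrite mul1r add0r.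
have [z Lz [r /eqP]] : L' 1 by rewrite L'T.
rewrite -subr_eq => /eqP zE; have [c c1] := linv r.
apply: LT; apply/seteqP; split=> // a _; rewrite -[a]mulr1; apply: (mulL).
by rewrite -c1 zE; exact: mulL.
Qed.

Lemma jacobson_radicalMl r x :
  jacobson_radical R x -> jacobson_radical R (r * x).
Proof.
by move=> Jx L maxL; have [[_ _ mulL] _ _] := maxL; apply: mulL; exact: Jx.
Qed.

(** The characterization by one-sided inverses becomes left-right symmetric
    through the classical remark that 1 - a b has a left inverse when 1 - b a
    has one, namely 1 + a c b if c is the given inverse. *)
Lemma jacobson_radicalMr x s :
  jacobson_radical R x -> jacobson_radical R (x * s).
Proof.
move=> /jacobson_radicalP linv; apply/jacobson_radicalP => r.
have [c c1] := linv (s * r); exists (1 + r * x * c * s).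
rewrite mulrDl mul1r.
have -> : r * x * c * s * (1 - r * (x * s)) = r * x * (c * (1 - s * r * x)) * s.
  by rewrite !(mulrBr, mulrBl, mulr1, mulrA).
by rewrite c1 mulr1 mulrA subrK.
Qed.

Lemma jacobson_radicalB x y :
  jacobson_radical R x -> jacobson_radical R y -> jacobson_radical R (x - y).
Proof.
move=> Jx Jy L maxL; have [[_ addL mulL] _ _] := maxL.
by apply: addL; [exact: Jx | rewrite -mulN1r; apply: mulL; exact: Jy].
Qed.

End JacobsonRadical.

(** * Invertible polynomials *)

(** Let a and P be the leading coefficient and the degree of g. Comparing the
    coefficients of t^(i + P) in h (1 - g) = 1, with i descending from the
    degree of h, expresses h_i a through the h_l with l > i; as a commutes with
    the coefficients of g, a power of a kills them all by induction. At i = 0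
    this is a power of a itself, because h_0 = 1. *)
Lemma lead_coef_nilpotent_of_inverse (A : nzRingType) (g h : {poly A}) :
  g`_0 = 0 -> (forall i, GRing.comm (lead_coef g) g`_i) -> h * (1 - g) = 1 ->
  exists k, lead_coef g ^+ k = 0.
Proof.
move=> g00 gC h1; exists (size h).
have [->|g0] := eqVneq g 0.
  have h0 : h != 0.
    by apply: contra_eq_neq h1 => ->; rewrite mul0r eq_sym oner_neq0.
  by rewrite lead_coef0 expr0n size_poly_eq0 (negPf h0).
set P := (size g).-1.
have szg : size g = P.+1 by rewrite prednK // size_poly_gt0.
have P_gt0 : (0 < P)%N.
  rewrite lt0n; apply: contra_neq g0 => P0; apply/eqP.
  by rewrite -lead_coef_eq0 lead_coefE -/P P0 g00.
set a := lead_coef g in gC *.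
have aE : a = g`_P by rewrite /a lead_coefE.
have key j : (j <= size h)%N -> h`_(size h - j) * a ^+ j = 0.
  elim/ltn_ind: j => -[_ _|j IH jh].
    by rewrite subn0 expr0 mulr1 nth_default.
  set i := (size h - j.+1)%N.
  have := congr1 (fun p : {poly A} => p`_(i + P)) h1.
  rewrite mulrBr mulr1 coefB coef1 -leqn0 leqNgt ltn_addl //= coefM.
  have iP : (i < (i + P).+1)%N by rewrite ltnS leq_addr.
  rewrite (bigD1 (Ordinal iP)) //= addKn -aE => eqi.
  have {}eqi : h`_i * a = h`_(i + P) -
     \sum_(l < (i + P).+1 | l != Ordinal iP) h`_l * g`_(i + P - l).
    by rewrite (subr0_eq eqi) addrK.
  have vanish l c : (i < l)%N -> GRing.comm a c -> h`_l * c * a ^+ j = 0.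
    move=> il ac; have [hl|lh] := leqP (size h) l.
      by rewrite nth_default // !mul0r.
    rewrite -mulrA (commrX j (commr_sym ac)) mulrA.
    rewrite -(subKn (ltnW lh)).
    have lj : (size h - l <= j)%N.
      by move: il lh jh; rewrite /i; lia.
    rewrite -(subnKC lj) exprD mulrA IH ?mul0r //; last exact: leq_subr.
  rewrite exprS mulrA eqi mulrBl mulr_suml big1 ?subr0.
    rewrite -[h`_ _]mulr1 vanish //; first by rewrite -[ltnLHS]addn0 ltn_add2l.
    exact: commr1.
  move=> l; rewrite -val_eqE /= => li; have [il|il|il] := ltngtP i l.
  - exact: vanish.
  - by rewrite [g`__]nth_default ?mulr0 ?mul0r // szg; lia.
  - by case/eqP: li.
have := key _ (leqnn _); rewrite subnn.
suff -> : h`_0 = 1 by rewrite mul1r.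
have := congr1 (fun p : {poly A} => p`_0) h1.
by rewrite mulrBr mulr1 coefB coef1 coefM big_ord1 g00 mulr0 subr0.
Qed.

(** * Semiprimitive Rees algebras *)

Section ReesSemiprimitive.
Variables (A : nzRingType) (F : filtration A).
Implicit Types (f : rees F) (a u : A).

Fact rees_homogeneous_subproof p a : F p a -> a%:P * 'X^p \in rees_pred F.
Proof.
move=> Fa; apply/asboolP => i; rewrite coefCM coefXn.
by case: eqP => [->|_]; rewrite ?mulr1 // mulr0; exact: fil0.
Qed.

Definition rees_homogeneous p a (Fa : F p a) : rees F :=
  Rees (rees_homogeneous_subproof Fa).

Lemma coef_rees_homogeneousM p a (Fa : F p a) f i :
  (rees_homogeneous Fa * f : rees F)`_i =
    if (i < p)%N then 0 else a * f`_(i - p).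
Proof. by rewrite /= -mulrA coefCM coefXnM; case: ifP; rewrite ?mulr0. Qed.

Lemma coef_reesM_homogeneous p a (Fa : F p a) f i :
  (f * rees_homogeneous Fa : rees F)`_i =
    if (i < p)%N then 0 else f`_(i - p) * a.
Proof. by rewrite /= mulrA coefMXn coefMC; case: ifP. Qed.

Lemma rees_eq0 f : (forall i, f`_i = 0) -> f = 0.
Proof. by move=> f0; apply/val_inj/polyP => i; rewrite f0 coef0. Qed.

(** Exhaustiveness places an arbitrary u of A in some F_d A, which makes u t^d
    and u t^(d+1) elements of the Rees algebra; so commutation relations and
    multiples can be taken with respect to all of A. *)
Lemma rees_semiprimitive :
  (forall a, a != 0 -> exists u, forall k, (a * u) ^+ k != 0) ->
  semiprimitive (rees F).
Proof.
move=> nonnil; apply/seteqP; split=> [f Jf|_ ->]; last first.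
  by move=> L [[]].
(* Induction on the width N of f: its coefficients live in [v, v + N). *)
suff width0 N : forall f v, jacobson_radical (rees F) f ->
    (forall i, (i < v)%N -> f`_i = 0) -> (size f <= v + N)%N -> f = 0.
  by apply: (width0 (size f) f 0%N).
move: f Jf => _ _; elim: N => [|N IH] f v Jf lo hi.
  apply: rees_eq0 => i; have [/lo //|vi] := ltnP i v.
  by rewrite nth_default // (leq_trans hi) ?addn0.
apply/eqP; apply: contraT => f0.
have pf0 : (f : {poly A}) != 0 by [].
set P := (size f).-1; set a := lead_coef f.
have szf : size f = P.+1 by rewrite prednK // size_poly_gt0.
have Fa : F P a by rewrite /a lead_coefE; have /asboolP := valP f; apply.
have aC u q : a * u * f`_q = f`_q * u * a.
  have [d Fu] := fil_exhaustive F u.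
  pose Ha := rees_homogeneous Fa; pose Hu := rees_homogeneous Fu.
  pose f' := Ha * (Hu * f) - f * Hu * Ha.
  have f'E i : f'`_i = if (i < P + d)%N then 0 else
      a * u * f`_(i - (P + d)) - f`_(i - (P + d)) * u * a.
    rewrite [LHS]coefB !(coef_rees_homogeneousM, coef_reesM_homogeneous).
    rewrite subnDA; have [iP|Pi] := ltnP i P.
      by rewrite (leq_trans iP) ?leq_addr // subrr.
    rewrite -(ltn_subLR _ Pi); case: ifP => _.
      by rewrite mulr0 mul0r subrr.
    by rewrite mulrA.
  (* The order of f' is at least P + d + v, and in degree P + d + P the two
     products contribute a u a - a u a. *)
  have f'0 : f' = 0.
    apply: (IH _ (P + d + v)%N).
    - apply: jacobson_radicalB; first by do 2 apply: jacobson_radicalMl.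
      by do 2 apply: jacobson_radicalMr.
    - move=> i iv; rewrite f'E; case: ltnP => // Pdi.
      by rewrite lo ?mulr0 ?mul0r ?subr0 // ltn_subLR.
    apply/leq_sizeP => i; move: hi; rewrite szf addnS ltnS => PvN hi.
    rewrite f'E; case: ltnP => // Pdi; set q' := (i - _)%N.
    have [Pq|] := ltnP P q'.
      by rewrite nth_default ?szf // mulr0 !mul0r subr0.
    rewrite leq_eqVlt => /orP[/eqP ->|qP]; first by rewrite -lead_coefE subrr.
    by rewrite /q' in qP; lia.
  have := congr1 (fun r : rees F => r`_(P + d + q)%N) f'0.
  rewrite [in LHS]f'E addKn ltnNge leq_addr /= coef0 => /eqP.
  by rewrite subr_eq0 => /eqP.
have [u unil] : exists u, forall k, (a * u) ^+ k != 0.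
  by apply: nonnil; rewrite lead_coef_eq0.
have [d Fu] := fil_exhaustive F u.
(* The exponent d + 1, instead of d, makes the constant coefficient of g 0. *)
pose g := f * rees_homogeneous (filS Fu).
have gE i : g`_i = if (i < d.+1)%N then 0 else f`_(i - d.+1) * u.
  exact: coef_reesM_homogeneous.
have lg : lead_coef g = a * u.
  have gP : g`_(d.+1 + P) = a * u.
    by rewrite gE ltnNge leq_addr addKn /= /a lead_coefE.
  have szg : size g = (d.+1 + P).+1.
    apply/eqP; rewrite eqn_leq; apply/andP; split; last first.
      rewrite ltnNge; apply/leq_sizeP => /(_ _ (leqnn _))/eqP.
      by rewrite gP (negPf (unil 1%N)).
    apply/leq_sizeP => i di; rewrite gE ltnNge (leq_trans _ di) /=.
      by rewrite nth_default ?mul0r // szf; lia.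
    by rewrite leqW ?leq_addr.
  by rewrite lead_coefE szg.
have Jg : jacobson_radical (rees F) g by exact: jacobson_radicalMr.
have /jacobson_radicalP/(_ 1)[h] := Jg; rewrite mul1r => /(congr1 val) /= h1.
have [||//|k /eqP] := @lead_coef_nilpotent_of_inverse A g h.
- by rewrite gE.
- move=> i; rewrite lg gE; case: ifP => _; first exact: commr0.
  by rewrite /GRing.comm mulrA aC mulrA.
- by rewrite lg (negPf (unil k)).
Qed.

End ReesSemiprimitive.

(** * Factors of periodic words *)

Section Words.
Variable T : eqType.
Implicit Types o a b c w v : seq T.

(** An occurrence of o that starts inside a ends inside b, since o is not longer
    than b. *)
Lemma infix_cat_overlap o a b c :
  (size o <= size b)%N -> infix o (a ++ b ++ c) ->
  infix o (a ++ b) || infix o (b ++ c).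
Proof.
move=> ob /infixP[p [s E]]; have [ap|pa] := leqP (size a) (size p).
  apply/orP; right; apply/infixP; exists (drop (size a) p), s.
  rewrite -[LHS](drop_size_cat (b ++ c) (erefl (size a))) E drop_cat.
  rewrite ltn_neqAle ap andbT; case: eqP => //= ->.
  by rewrite subnn drop0 drop_size.
apply/orP; left; apply/infixP.
exists p, (take (size a + size b - (size p + size o))%N s).
rewrite -(take_size_cat c (erefl (size (a ++ b)))) -catA E size_cat.
rewrite take_cat ltnNge (leq_trans (ltnW pa)) ?leq_addr //=; congr (_ ++ _).
rewrite take_cat ltnNge (_ : (size o <= _)%N) /=; last by lia.
by congr (_ ++ take _ _); lia.
Qed.

(** The windows of length at most |w| of a word of period w v are already
    visible in one period prolonged by w: both w v . w v ... w and its tail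
    after the first period start with w, so the previous lemma peels off one
    period at a time. *)
Lemma infix_periodic o w v k :
  (size o <= size w)%N -> infix o (flatten (nseq k (w ++ v)) ++ w) ->
  infix o (w ++ v ++ w).
Proof.
move=> ow; elim: k => [|k IH] /=; first by move/infix_catr; exact.
have [r rE] : exists r, flatten (nseq k (w ++ v)) ++ w = w ++ r.
  case: k {IH} => [|k] /=; first by exists [::]; rewrite cats0.
  by eexists; rewrite -!catA.
rewrite -catA rE => /(infix_cat_overlap ow)/orP[]; first by rewrite -catA.
by rewrite -rE.
Qed.

End Words.

(** * The weighted graded lexicographic ordering *)

Section LexicographicOrder.
Variables (T : eqType) (le : rel T).
Implicit Types s t a c d : seq T.

Lemma lex_lt_irr s : lex_lt le s s = false.
Proof. by elim: s => //= x s IH; rewrite eqxx. Qed.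

Lemma lex_lt_total s t : total le -> s != t -> lex_lt le s t || lex_lt le t s.
Proof.
move=> leT; elim: s t => [|x s IH] [|y t] //=.
rewrite eqseq_cons [y == x]eq_sym; case: eqVneq => [_|_ _]; last exact: leT.
exact: IH.
Qed.

Lemma lex_lt_trans :
  antisymmetric le -> transitive le -> transitive (lex_lt le).
Proof.
move=> leA leTr; elim=> [|y t IH] [|x s] [|z r] //=.
case: (eqVneq x y) => [->|xy].
  by case: eqP => // _; exact: IH.
case: (eqVneq y z) => [<-|yz]; first by rewrite (negPf xy).
move=> lxy lyz; case: (eqVneq x z) => [xz|_]; last exact: leTr lyz.
by case/eqP: xy; apply: leA; rewrite lxy xz lyz.
Qed.

Lemma lex_lt_catl a s t : lex_lt le (a ++ s) (a ++ t) = lex_lt le s t.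
Proof. by elim: a => //= x a ->; rewrite eqxx. Qed.

(** Without the hypothesis on prefixes this fails: x precedes x y, but x z
    follows x y when z is greater than y. *)
Lemma lex_lt_catr s t c d :
  ~~ prefix s t -> lex_lt le s t -> lex_lt le (s ++ c) (t ++ d).
Proof.
elim: s t => [|x s IH] [|y t] //=.
by case: eqP => //= _; exact: IH.
Qed.

End LexicographicOrder.

Section GradedLex.
Variables (n : nat) (m : 'I_n -> nat) (le : rel 'I_n).
Hypothesis m_gt0 : forall i, (0 < m i)%N.
Hypotheses (leA : antisymmetric le) (leT : transitive le) (leTot : total le).
Implicit Types u v w s : word n.
Local Notation lt := (grlex_lt m le).

Lemma size_le_wdeg w : (size w <= wdeg m w)%N.
Proof. by rewrite -sum1_size; exact: leq_sum. Qed.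

Lemma grlex_lt_irr w : lt w w = false.
Proof. by rewrite /grlex_lt ltnn lex_lt_irr andbF. Qed.

Lemma grlex_lt_trans : transitive lt.
Proof.
move=> v u w /orP[uv|/andP[/eqP uv luv]] /orP[vw|/andP[/eqP vw lvw]]; apply/orP.
- by left; exact: ltn_trans vw.
- by left; rewrite -vw.
- by left; rewrite uv.
- by right; rewrite uv vw eqxx (lex_lt_trans leA leT luv lvw).
Qed.

Lemma grlex_lt_total u v : u <> v -> lt u v || lt v u.
Proof.
move=> /eqP uv; rewrite /grlex_lt; case: ltngtP => //= _.
by apply: lex_lt_total.
Qed.

Lemma grlex_lt_mull w u v : lt u v -> lt (mmul w u) (mmul w v).
Proof. by rewrite /grlex_lt !wdegM !fmM lex_lt_catl ltn_add2l eqn_add2l. Qed.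

(** In equal degrees neither word is a proper prefix of the other, as all
    letters have positive weight; hence the lexicographic comparison is decided
    at a letter and survives multiplication on the right. *)
Lemma grlex_lt_mulr w u v : lt u v -> lt (mmul u w) (mmul v w).
Proof.
rewrite /grlex_lt !wdegM !fmM ltn_add2r eqn_add2r.
case/orP=> [->//|/andP[uv luv]]; apply/orP; right; rewrite uv /=.
apply: lex_lt_catr => //; apply/negP => /prefixP[[|x r] vE].
  by move: luv; rewrite vE cats0 lex_lt_irr.
by move: uv (m_gt0 x); rewrite /wdeg vE big_cat big_cons /=; lia.
Qed.

Lemma grlex_lt_mul u u' v v' :
  u = u' \/ lt u u' -> v = v' \/ lt v v' -> (u, v) <> (u', v') ->
  lt (mmul u v) (mmul u' v').
Proof.
case=> [->|uu'] [->|vv'] // _; first exact: grlex_lt_mull.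
  exact: grlex_lt_mulr.
exact: grlex_lt_trans (grlex_lt_mulr _ uu') (grlex_lt_mull _ vv').
Qed.

(** Words of weighted degree at most D have length at most D, so that only
    finitely many words precede a given one; the induction is on their number. *)
Lemma grlex_wf (P : word n -> Prop) :
  (forall w, (forall v, lt v w -> P v) -> P w) -> forall w, P w.
Proof.
move=> IH w; have [D] := ubnP (wdeg m w).
pose below u := finset (fun v : {bseq D of 'I_n} => lt (FMonom v) u).
have [N] := ubnP #|below w|; elim: N w => // N IHN w; rewrite ltnS => cw wD.
apply: IH => v vw.
have vw' : (wdeg m v <= wdeg m w)%N by case/orP: vw => [/ltnW//|/andP[/eqP->]].
apply: IHN; last exact: leq_ltn_trans wD.
apply: leq_trans cw; apply: proper_card; apply/properP; split.
  by apply/fintype.subsetP => x; rewrite !inE => /grlex_lt_trans; exact.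
have vD : (size v <= D)%N.
  by rewrite (leq_trans (size_le_wdeg v)) // (leq_trans vw') // ltnW.
by exists (Bseq vD); rewrite inE /= fmK // grlex_lt_irr.
Qed.

End GradedLex.

(** * Normal words and monomial algebras *)

Definition normal n (Omega : set (word n)) (w : word n) :=
  forall o, Omega o -> ~ word_divides o w.

Lemma word_dividesP n (o w : word n) : word_divides o w <-> infix o w.
Proof.
split=> [[p [s ->]]|/infixP[p [s E]]].
  by rewrite !fmM -catA; apply/infixP; exists p, s.
exists (FMonom p), (FMonom s); apply/eqP.
by rewrite fmP !fmM E catA.
Qed.

Section MonomialIdeal.
Variables (K : fieldType) (n : nat) (Omega : set (word n)).
Implicit Types (x y : free_algebra K n) (w : word n).

(** This is the monomial ideal of Omega, described by supports: membership in it
    can be tested word by word, and it contains the generators. *)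
Definition no_normal_words : {malg K[word n]} -> bool :=
  fun x => `[< forall w, w \in msupp x -> ~ normal Omega w >].

Fact no_normal_words_zmod : zmod_closed no_normal_words.
Proof.
split=> [|x y /asboolP Ox /asboolP Oy]; apply/asboolP => w.
  by rewrite msupp0 inE.
by move=> /(fsubsetP (msuppB_le x y)); rewrite in_fsetU => /orP[/Ox|/Oy].
Qed.

HB.instance Definition _ :=
  GRing.isZmodClosed.Build _ no_normal_words no_normal_words_zmod.

Lemma normalM u v : normal Omega (mmul u v) -> normal Omega u /\ normal Omega v.
Proof.
move=> uvN; split=> o /uvN + /word_dividesP => /[swap] ou; apply.
  by apply/word_dividesP; rewrite fmM infix_catr.
by apply/word_dividesP; rewrite fmM infix_catl.
Qed.

Fact no_normal_wordsMl x y : y \in no_normal_words -> x * y \in no_normal_words.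
Proof.
move=> /asboolP Oy; apply/asboolP => w /msuppM_le[u [v [_ /Oy vN ->]]].
by move=> /normalM[_].
Qed.

Fact no_normal_wordsMr x y : y \in no_normal_words -> y * x \in no_normal_words.
Proof.
move=> /asboolP Oy; apply/asboolP => w /msuppM_le[u [v [/Oy uN _ ->]]].
by move=> /normalM[].
Qed.

HB.instance Definition _ := isTwoSided.Build _ no_normal_words
  no_normal_wordsMl no_normal_wordsMr.

Lemma monomial_ideal_not_normal x w :
  x \in monomial_ideal K Omega -> w \in msupp x -> ~ normal Omega w.
Proof.
move=> /ideal_genP xO; move: w; apply/asboolP.
apply: (xO (TwoSidedIdeal.clone (free_algebra K n) no_normal_words _)).
move=> _ [v Ov <-]; apply/asboolP => w.
rewrite msuppU1 inE => /eqP -> /(_ v Ov).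
by apply; exists mone, mone; rewrite mul1m mulm1.
Qed.

Lemma mem_monomial_ideal w :
  ((<< w >> : free_algebra K n) \in monomial_ideal K Omega) <->
  ~ normal Omega w.
Proof.
split=> [wO|].
  by apply: (monomial_ideal_not_normal wO); rewrite msuppU1 inE.
move=> /existsNP[o /not_implyP[Oo /contrapT[p [s ->]]]].
have -> : (<< mmul (mmul p o) s >> : free_algebra K n) =
    << p >> * << o >> * << s >>.
  by rewrite !malgM_def !fgmulUU !mulr1.
apply/two_sidedMr/two_sidedMl/ideal_genP => J; apply; by exists o.
Qed.

(** If no w v w is normal, then w r w is 0 in the monomial algebra for every word
    r, hence by linearity for every r, so that semi-primeness makes w itself 0. *)
Lemma semiprime_sandwich :
  semiprime (quot_ring (monomial_ideal K Omega)) -> forall w, normal Omega w ->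
  exists v, normal Omega (mmul (mmul w v) w).
Proof.
move=> sp w wN; apply: contrapT => /forallNP noN.
have /eqP : quot_pi (monomial_ideal K Omega) << w >> = 0.
  apply: sp; elim/quot_ringW => y.
  rewrite -(rmorphM (quot_pi _) << w >>) -(rmorphM (quot_pi _) (_ * y)).
  apply/eqP; rewrite quot_pi_eq0 [y]monalgE mulr_sumr mulr_suml.
  apply: rpred_sum => v _.
  have -> : << y@_v *g v >> = (y@_v)%:MP * << v >> :> free_algebra K n.
    by rewrite malgM_def fgmulUU mulr1 mul1m.
  have -> : << w >> * ((y@_v)%:MP * << v >>) * << w >> =
      (y@_v)%:MP * << mmul (mmul w v) w >> :> free_algebra K n.
    by rewrite !malgM_def !fgmulUU !(mulr1, mul1r, mul1m).
  exact/two_sidedMl/mem_monomial_ideal/noN.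
by rewrite quot_pi_eq0 => /mem_monomial_ideal.
Qed.

End MonomialIdeal.

(** The sandwich hypothesis first extends w on the right to some w y of length at
    least L; a second use of it gives v with (w y) v (w y) normal, and u = y v
    works because the forbidden words, of length at most L, cannot tell the
    powers of (w y) v from this single sandwich. The empty word has to be set
    apart, since sandwiches of it need not grow. *)
Lemma normal_power n (Omega : set (word n)) (L : nat) :
  (forall o, Omega o -> (size o <= L)%N) -> normal Omega mone ->
  (forall w, normal Omega w -> exists v, normal Omega (mmul (mmul w v) w)) ->
  forall w, normal Omega w -> exists u, forall k,
    normal Omega (FMonom (flatten (nseq k (mmul w u : seq 'I_n)))).
Proof.
move=> Obound N1 sandwich w wN.
have [w1|w1] := eqVneq w mone.
  exists mone => k o Oo /word_dividesP /=.
  have -> : flatten (nseq k (mmul w mone : seq 'I_n)) = (mone : word n).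
    by rewrite w1 mulm1 fm1; elim: k.
  by move=> o1; apply: (N1 o Oo); apply/word_dividesP.
have w_gt0 : (0 < size w)%N by rewrite lt0n (fdeg_eq0 w).
have [y Ly yN] : exists2 y, (L <= size (mmul w y))%N & normal Omega (mmul w y).
  elim: {Obound}L => [|L [y Ly yN]]; first by exists mone; rewrite ?mulm1.
  have [v vN] := sandwich _ yN; exists (mmul y (mmul v (mmul w y))).
    move: Ly; rewrite !fmM !size_cat; lia.
  by rewrite !mulmA in vN *.
have [v vN] := sandwich _ yN; exists (mmul y v) => k o Oo /word_dividesP /= od.
have : infix o (flatten (nseq k ((mmul w y : seq 'I_n) ++ v)) ++ mmul w y).
  by apply: infix_catr; rewrite mulmA fmM in od.
move=> /(infix_periodic (leq_trans (Obound o Oo) Ly)) od'.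
by apply: (vN o Oo); apply/word_dividesP; rewrite fmM fmM -catA.
Qed.

(** * Leading monomials *)

Section LeadingMonomial.
Variables (K : fieldType) (n : nat) (m : 'I_n -> nat) (le : rel 'I_n).
Hypothesis m_gt0 : forall i, (0 < m i)%N.
Hypotheses (leA : antisymmetric le) (leT : transitive le) (leTot : total le).
Implicit Types (x y g : free_algebra K n) (u v w s : word n).
Local Notation lt := (grlex_lt m le).

Lemma is_LM_exists x : x <> 0 -> exists w, is_LM lt x w.
Proof.
move=> /eqP; rewrite -msupp_eq0 => x0.
suff max (r : seq (word n)) : r != [::] ->
    exists2 w, w \in r & forall v, v \in r -> v <> w -> lt v w.
  have [|w] := max (msupp x); last by exists w.
  apply: contra x0 => /eqP r0; apply/eqP/fsetP => w.
  by rewrite in_fset0 -[LHS]/(w \in (msupp x : seq _)) r0.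
elim: r => // a r IH _; have [->|/IH[w wr wmax]] := eqVneq r [::].
  by exists a => [|v]; rewrite inE // => /eqP.
have [aw|/eqP aw] := eqVneq a w.
  exists w => [|v]; first by rewrite inE wr orbT.
  by rewrite inE aw => /orP[/eqP//|]; exact: wmax.
case/orP: (grlex_lt_total m leTot aw) => [law|lwa].
  by exists w => [|v]; rewrite inE ?wr ?orbT // => /orP[/eqP->|/wmax].
exists a => [|v]; first by rewrite inE eqxx.
rewrite inE => /orP[/eqP//|vr _]; have [->//|/eqP vw] := eqVneq v w.
exact: (grlex_lt_trans leA leT (wmax v vr vw)).
Qed.

Lemma is_LMU w : is_LM lt (<< w >> : free_algebra K n) w.
Proof.
by split=> [|v]; rewrite msuppU1 inE // => /eqP.
Qed.

Lemma is_LM_le x w u : is_LM lt x w -> u \in msupp x -> u = w \/ lt u w.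
Proof.
by move=> [_ wmax] ux; have [|/eqP] := eqVneq u w; [left | right; exact: wmax].
Qed.

Lemma is_LM_neq0 x w : is_LM lt x w -> x <> 0.
Proof. by move=> [+ _] x0; rewrite x0 msupp0 inE. Qed.

(** By strict monotonicity of the product of words, w v is the product of a word
    of x and a word of y in one way only. *)
Lemma mcoeff_LM_mul x y w v :
  is_LM lt x w -> is_LM lt y v -> (x * y)@_(mmul w v) = x@_w * y@_v.
Proof.
move=> xw yv; have [wx _] := xw; have [vy _] := yv.
rewrite mcoeffMl (bigD1_seq w) ?fset_uniq //= (bigD1_seq v) ?fset_uniq //= eqxx.
rewrite big_seq_cond big1 ?addr0 => [|v' /andP[v'y v'v]].
  rewrite big_seq_cond big1 ?addr0 // => w' /andP[w'x w'w].
  rewrite big_seq big1 // => v' v'y; case: eqP => // E.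
  have : lt (mmul w' v') (mmul w v).
    apply: (grlex_lt_mul m_gt0 leA leT); first exact: is_LM_le w'x.
      exact: is_LM_le v'y.
    by case=> w'w1 _; rewrite w'w1 eqxx in w'w.
  by rewrite E grlex_lt_irr.
case: eqP => // E.
have := grlex_lt_mull w (proj2 yv v' v'y (elimN eqP v'v)).
by rewrite E grlex_lt_irr.
Qed.

Lemma is_LM_mul x y w v :
  is_LM lt x w -> is_LM lt y v -> is_LM lt (x * y) (mmul w v).
Proof.
move=> xw yv; have [wx _] := xw; have [vy _] := yv; split.
  by rewrite -mcoeff_neq0 (mcoeff_LM_mul xw yv) mulf_neq0 // mcoeff_neq0.
move=> u /msuppM_le[w' [v' [w'x v'y ->]]] ne.
apply: (grlex_lt_mul m_gt0 leA leT); first exact: is_LM_le w'x.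
  exact: is_LM_le v'y.
by case=> ww vv; apply: ne; rewrite ww vv.
Qed.

Lemma is_LM_exp x w k :
  is_LM lt x w -> is_LM lt (x ^+ k) (FMonom (flatten (nseq k (w : seq 'I_n)))).
Proof.
move=> xw; elim: k => [|k IH] /=; first by rewrite expr0 -fmoneE; exact: is_LMU.
rewrite exprS; have := is_LM_mul xw IH; congr is_LM.
by apply/eqP; rewrite fmP fmM.
Qed.

Lemma LM_size_bounded (G : seq (free_algebra K n)) :
  exists L, forall o, LM lt [set` G] o -> (size o <= L)%N.
Proof.
exists (\max_(g <- G) \max_(w <- msupp g) size w)%N => o [g [gG _ [og _]]].
apply: (@leq_trans (\max_(w <- msupp g) size w)%N).
  exact: (@leq_bigmax_seq _ _ xpredT (fun w : word n => size w)).
exact: (@leq_bigmax_seq _ _ xpredT (fun x => \max_(w <- msupp x) size w)%N).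
Qed.

(** * Normal representatives modulo a Groebner basis *)

Section Groebner.
Variables (G : set (free_algebra K n)) (I : twoSidedIdeal (free_algebra K n)).
Hypothesis G_groebner : groebner_basis lt G I.
Local Notation Omega := (LM lt G).

Lemma normal_LM_notin x w : is_LM lt x w -> normal Omega w -> x \notin I.
Proof.
move=> xw wN; apply/negP => xI.
have /mem_monomial_ideal :
    (<< w >> : free_algebra K n) \in monomial_ideal K Omega.
  rewrite -(proj2 G_groebner); apply/ideal_genP => J; apply.
  by exists w => //; exists x; split=> //; exact: is_LM_neq0 xw.
exact.
Qed.

(** This is the division algorithm, stopped as soon as the leading monomial is
    normal: a leading monomial p o s, with o the leading monomial of some g in
    G, is removed by subtracting a multiple of p g s, and the ordering is
    well-founded. *)
Lemma normal_LM_repr x :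
  x \notin I -> exists y w, [/\ x - y \in I, is_LM lt y w & normal Omega w].
Proof.
move=> xI; have /is_LM_exists[w xw] : x <> 0.
  by move=> x0; rewrite x0 rpred0 in xI.
elim/(grlex_wf m_gt0 leA leT): w => w IH in x xI xw *.
have [wN|] := pselect (normal Omega w).
  by exists x, w; split=> //; rewrite subrr rpred0.
move=> /existsNP[o /not_implyP[[g [Gg _ go]] /contrapT[p [s wE]]]].
have gI : g \in I by have [] := proj1 G_groebner g Gg.
pose z : free_algebra K n := << p >> * g * << s >>.
have zw : is_LM lt z w.
  rewrite wE; apply: is_LM_mul (is_LMU s).
  by apply: is_LM_mul go; exact: is_LMU.
pose c := x@_w / z@_w; pose x' := x - c%:MP * z.
have xx' : x - x' \in I.
  by rewrite subKr; apply/two_sidedMl/two_sidedMr/two_sidedMl.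
have x'I : x' \notin I.
  by apply: contra xI => x'I; rewrite -(subrK x' x) rpredD.
have /is_LM_exists[w' x'w'] : x' <> 0 by move=> x0; rewrite x0 rpred0 in x'I.
have w'w : lt w' w.
  have [w'x' _] := x'w'; have [wz _] := zw.
  have ne : w' <> w.
    move=> E; move: w'x'; rewrite E -mcoeff_neq0 mcoeffB mcoeffCM.
    by rewrite divfK ?subrr ?eqxx // mcoeff_neq0.
  move: w'x' => /(fsubsetP (msuppB_le _ _)); rewrite in_fsetU => /orP[w'x|].
    exact: (proj2 xw).
  rewrite mul_malgC => /(fsubsetP (msuppZ_le _ _)) w'z.
  exact: (proj2 zw).
have [y [v [x'y yv vN]]] := IH w' w'w x' x'I x'w'.
by exists y, v; split=> //; rewrite -(subrKA x') rpredD.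
Qed.

End Groebner.
End LeadingMonomial.

Unset Implicit Arguments.

Theorem theorem3p5 (K : fieldType) (n : nat)
  (m : 'I_n -> nat) (m_gt0 : forall i, (0 < m i)%N)
  (leX : rel 'I_n) (leX_anti : antisymmetric leX) (leX_trans : transitive leX)
  (leX_total : total leX)
  (G : seq (free_algebra K n))
  (I : properTwoSidedIdeal (free_algebra K n))
  (I_gen : I =i ideal_gen [set` G])
  (G_groebner : groebner_basis (grlex_lt m leX) [set` G] I)
  (LMG_letters : LM (grlex_lt m leX) [set` G] `&` letters n = set0)
  (LMG_reduced : reduced (LM (grlex_lt m leX) [set` G])) :
  semiprime (quot_ring (monomial_ideal K (LM (grlex_lt m leX) [set` G]))) ->
  semiprimitive (rees (quot_filtration (weight_filtration K m) I)).
Proof.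
move=> sp; apply: rees_semiprimitive => a a0.
pose Omega := LM (grlex_lt m leX) [set` G].
have [x aE xI] : exists2 x, a = quot_pi I x & x \notin I.
  by exists (quot_repr a); rewrite ?quot_reprK // -quot_pi_eq0 quot_reprK.
have [y [w [xy yw wN]]] :=
  normal_LM_repr m_gt0 leX_anti leX_trans leX_total G_groebner xI.
have [L Obound] := LM_size_bounded m leX G.
have N1 : normal Omega mone.
  by have := wN; rewrite -[w]mul1m => /normalM[].
have [u uN] := normal_power Obound N1 (semiprime_sandwich sp) wN.
exists (quot_pi I << u >>) => k.
have -> : a = quot_pi I y by rewrite aE; apply/quot_piP.
rewrite -rmorphM -rmorphXn quot_pi_eq0.
apply: (normal_LM_notin G_groebner _ (uN k)).
apply: is_LM_exp => //; apply: is_LM_mul => //; exact: is_LMU.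
Qed.
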